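(* Let $A$ be a ring. Let $B$ be an $A$-algebra. Let $(I_\rho)_{\rho\in\mathbb{N}}$ be an ideal semifiltration of $A$. Let $x\in B$ and $y\in B$. Let $m\in\mathbb{N}$ and $n\in\mathbb{N}$. Assume that $x$ is $m$-integral over $\left(A,(I_\rho)_{\rho\in\mathbb{N}}\right)$, and that $y$ is $n$-integral over $\left(A,(I_\rho)_{\rho\in\mathbb{N}}\right)$. Then $x+y$ is $nm$-integral over $\left(A,(I_\rho)_{\rho\in\mathbb{N}}\right)$.
   Context: All rings are commutative with unity, and ''$A$-algebra'' means commutative unital $A$-algebra (the structure map $A\to B$ need not be injective). $\mathbb{N}=\{0,1,2,\ldots\}$. An ideal semifiltration of a ring $A$ is a sequence $(I_\rho)_{\rho\in\mathbb{N}}$ of ideals of $A$ such that $I_0=A$ and $I_aI_b\subseteq I_{a+b}$ for all $a,b\in\mathbb{N}$. Given an ideal semifiltration $(I_\rho)_{\rho\in\mathbb{N}}$ of $A$ and $n\in\mathbb{N}$, an element $u$ of an $A$-algebra $B$ is called $n$-integral over $(A,(I_\rho)_{\rho\in\mathbb{N}})$ if there exists $(a_0,a_1,\ldots,a_n)\in A^{n+1}$ such that $\sum_{k=0}^{n}a_ku^k=0$, $a_n=1$, and $a_i\in I_{n-i}$ for every $i\in\{0,1,\ldots,n\}$. *)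

(* Defs.v *)
From HB Require Import structures.
From mathcomp Require Import all_boot all_order all_algebra.

Set Implicit Arguments.
Unset Strict Implicit.
Unset Printing Implicit Defensive.

Import GRing.Theory.
Local Open Scope ring_scope.

(* Rings may be trivial, hence comPzRingType. Since comAlgType excludes the    *)
(* zero ring, an A-algebra is a ring B with a structure morphism               *)
(* iota : {rmorphism A -> B}, and the scalar action of a on v is iota a * v.   *)
(* The notion Idealr of ring_quotient covers only decidable proper ideals of   *)
(* nontrivial rings, hence the Prop-valued definition below.                   *)

Definition is_ideal (A : comPzRingType) (I : A -> Prop) : Prop :=
  [/\ I 0,
      forall x y : A, I x -> I y -> I (x + y)
    & forall a x : A, I x -> I (a * x)].

Definition ideal_mul (A : comPzRingType) (I J : A -> Prop) (x : A) : Prop :=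
  exists (k : nat) (a b : 'I_k -> A),
    [/\ forall i, I (a i), forall i, J (b i) & x = \sum_(i < k) a i * b i].

Definition ideal_semifiltration (A : comPzRingType) (I : nat -> A -> Prop) :
    Prop :=
  [/\ forall r : nat, is_ideal (I r),
      forall x : A, I 0%N x
    & forall (a b : nat) (x : A), ideal_mul (I a) (I b) x -> I (a + b)%N x].

Definition n_integral (A B : comPzRingType) (iota : {rmorphism A -> B})
    (I : nat -> A -> Prop) (n : nat) (u : B) : Prop :=
  exists a : 'I_n.+1 -> A,
    [/\ \sum_(k < n.+1) iota (a k) * u ^+ k = 0,
        a ord_max = 1
      & forall i : 'I_n.+1, I (n - i)%N (a i)].

(* Main.v *)
Require Import Defs.
From HB Require Import structures.
From mathcomp Require Import all_boot all_order all_algebra.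
Import GRing.Theory.
Local Open Scope ring_scope.

Set Implicit Arguments.
Unset Strict Implicit.

(** Without the ideals, the statement is the effective form of the closure of
    integral elements under addition: if [x] and [y] are roots of monic
    polynomials of degrees [m] and [n] with coefficients in a subring [S], then
    multiplication by [x + y] acts on the [m * n] products [x ^+ i * y ^+ j]
    through a matrix [M] with entries in [S], built from the companion matrices
    of the two polynomials.  The vector of these products is thus an
    eigenvector of [M] for [x + y]; as one of its entries is [1], the
    characteristic polynomial of [M], which is monic of degree [m * n] and has
    its coefficients in [S], vanishes at [x + y] ([sum_root_monic_subring]).

    The ideals are brought in by homogenization.  Let [S] be the Rees algebra
    of the semifiltration, that is, the polynomials over [A] whose coefficient
    of degree [i] lies in [I i].  If [u] is [n]-integral over the
    semifiltration, then multiplying the coefficient of index [k] by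
    ['X^(n - k)] shows that [u%:P * 'X] is a root of a monic polynomial of
    degree [n] over [S] ([Rees_integral]).  Conversely, such a relation for
    [u%:P * 'X], read in degree [n], is an [n]-integrality relation for [u]
    ([integral_of_Rees]).  So the first paragraph, applied to [x%:P * 'X] and
    [y%:P * 'X] over the Rees algebra, gives the theorem.

    Polynomials are formed over nonzero rings only, so the case where [B] is
    the zero ring is set aside; its element is [n]-integral for every [n]. *)

(** * Multiplicative filtrations by additive subgroups *)

(** Common generalization of an ideal semifiltration and of a constant family
    equal to a subring: what is needed for the polynomials with coefficient of
    degree [i] in [I i] to form a ring. *)
Definition subgroup_filtration (A : comPzRingType) (I : nat -> A -> Prop) :=
  [/\ I 0%N 1,
      forall i, I i 0,
      forall i a b, I i a -> I i b -> I i (a - b)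
    & forall i j a b, I i a -> I j b -> I (i + j)%N (a * b)].

Definition is_subring (A : comPzRingType) (S : A -> Prop) :=
  [/\ S 1, forall a b, S a -> S b -> S (a - b)
    & forall a b, S a -> S b -> S (a * b)].

(** For a constant family equal to a subring [S], this is the ring of
    polynomials with coefficients in [S]. *)
Definition Rees (A : comNzRingType) (I : nat -> A -> Prop) (p : {poly A}) :=
  forall i, I i p`_i.

Section Subring.

Variables (A : comPzRingType) (S : A -> Prop).
Hypothesis hS : is_subring S.

Lemma subring0 : S 0.
Proof. by case: hS => S1 SB _; rewrite -(subrr 1); apply: SB. Qed.

Lemma subringN a : S a -> S (- a).
Proof.
by case: hS => _ SB _ Sa; rewrite -sub0r; apply: SB => //; apply: subring0.
Qed.

Lemma subringD a b : S a -> S b -> S (a + b).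
Proof.
case: hS => _ SB _ Sa Sb; rewrite -[b]opprK.
by apply: SB => //; apply: subringN.
Qed.

Lemma subring_nat (b : bool) : S b%:R.
Proof. by case: b; [case: hS | exact: subring0]. Qed.

Lemma subring_sum (T : finType) (F : T -> A) :
  (forall i, S (F i)) -> S (\sum_i F i).
Proof.
by move=> SF; apply: big_ind => //; [exact: subring0 | exact: subringD].
Qed.

Lemma subring_prod (T : finType) (F : T -> A) :
  (forall i, S (F i)) -> S (\prod_i F i).
Proof. by case: hS => S1 _ SM SF; apply: big_ind. Qed.

Lemma subring_det n (M : 'M[A]_n) : (forall i j, S (M i j)) -> S (\det M).
Proof.
case: hS => S1 _ SM hM; apply: subring_sum => s; apply: SM.
  by case: (perm.odd_perm s); rewrite ?expr0 ?expr1 //; apply: subringN.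
exact: subring_prod.
Qed.

Lemma subring_mulmx m n p (M : 'M[A]_(m, n)) (N : 'M[A]_(n, p)) :
  (forall i j, S (M i j)) -> (forall i j, S (N i j)) ->
  forall i j, S ((M *m N) i j).
Proof.
case: hS => _ _ SM hM hN i j; rewrite mxE.
by apply: subring_sum => k; apply: SM.
Qed.

Lemma subring_lin_mx m1 n1 m2 n2 (f : 'M[A]_(m1, n1) -> 'M[A]_(m2, n2)) :
  (forall M : 'M[A]_(m1, n1), (forall i j, S (M i j)) ->
     forall i j, S (f M i j)) ->
  forall i j, S (lin_mx f i j).
Proof.
move=> hf i j; case/mxvec_indexP: i => i1 i2; case/mxvec_indexP: j => j1 j2.
rewrite !mxE /= mxvecE vec_mx_delta; apply: hf => k l.
by rewrite mxE; apply: subring_nat.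
Qed.

Lemma subring_filtration : subgroup_filtration (fun _ => S).
Proof. by case: hS => S1 SB SM; split=> // _; exact: subring0. Qed.

End Subring.

Lemma Rees_subring (A : comNzRingType) (I : nat -> A -> Prop) :
  subgroup_filtration I -> is_subring (Rees I).
Proof.
case=> I1 I0 IB IM; split=> [i | p q hp hq i | p q hp hq i].
- by rewrite coef1; case: i.
- by rewrite coefB; apply: IB.
have ID a b : I i a -> I i b -> I i (a + b).
  by move=> ha hb; rewrite -[b]opprK; apply: (IB) => //; rewrite -sub0r; apply: IB.
rewrite coefM; apply: big_ind => // j _.
by rewrite -[i in I i _](subnKC (leq_ord j)); apply: IM.
Qed.

Lemma semifiltration_subgroup (A : comPzRingType) (I : nat -> A -> Prop) :
  ideal_semifiltration I -> subgroup_filtration I.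
Proof.
case=> idI I0 IM; split=> // [i | i a b ha hb | i j a b ha hb].
- by case: (idI i).
- by case: (idI i) => _ ID IZ; apply: ID => //; rewrite -mulN1r; apply: IZ.
apply: IM; exists 1%N, (fun=> a), (fun=> b).
by split=> //; rewrite big_ord1.
Qed.

(** * The determinant trick *)

(** The polynomials with coefficients in [S] form a subring, which contains the
    entries of the matrix whose determinant is the characteristic polynomial. *)
Lemma subring_char_poly (A : comNzRingType) (S : A -> Prop) n (M : 'M[A]_n) :
  is_subring S -> (forall i j, S (M i j)) -> forall k, S (char_poly M)`_k.
Proof.
move=> hS hM; have hP := Rees_subring (subring_filtration hS).
apply: (subring_det hP) => i j k; rewrite !mxE coefB coefC coefMn coefX.
case: (hS) => _ SB _; apply: SB; last first.
  by case: (k == 0%N); [exact: hM | exact: subring0].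
by rewrite -mulrnA mulnb; exact: subring_nat.
Qed.

(** Multiply [v *m (z%:M - M) = 0] by the adjugate. *)
Lemma char_poly_eigen (R : comNzRingType) n (M : 'M[R]_n) (v : 'rV[R]_n) z :
  v *m M = z *: v -> (char_poly M).[z] *: v = 0.
Proof.
move=> hv.
have -> : (char_poly M).[z] = \det (z%:M - M).
  rewrite -horner_evalE -det_map_mx; congr (\det _); apply/matrixP=> i j.
  by rewrite !mxE /= horner_evalE hornerD hornerN hornerC hornerMn hornerX.
rewrite -mul_mx_scalar -mul_mx_adj mulmxA.
by rewrite mulmxBr mul_mx_scalar hv subrr mul0mx.
Qed.

(** [C] is the companion matrix of a monic polynomial over [S] that vanishes at
    [x]: the last row uses this polynomial to rewrite [x ^+ m], and each other
    row shifts to the next power. *)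
Lemma companion_eigen (A B : comPzRingType) (iota : {rmorphism A -> B})
    (S : A -> Prop) m (x : B) :
  is_subring S -> n_integral iota (fun _ => S) m x ->
  exists2 C : 'M[A]_m, forall i j, S (C i j)
    & map_mx iota C *m \col_(i < m) x ^+ i = x *: \col_(i < m) x ^+ i.
Proof.
move=> hS [a [ha a1 Sa]].
exists (\matrix_(i, k) if i.+1 == m then - a (widen_ord (leqnSn m) k)
                       else ((k : nat) == i.+1)%:R).
  move=> i k; rewrite mxE; case: ifP => _; last exact: subring_nat.
  exact: subringN.
apply/matrixP=> i j; rewrite !mxE -exprS.
case: (eqVneq i.+1 m) => [im | ni].
  move: ha; rewrite big_ord_recr /= a1 rmorph1 mul1r => /eqP.
  rewrite addr_eq0 => /eqP ha; rewrite im -[RHS]opprK -ha -sumrN.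
  by apply: eq_bigr => k _; rewrite !mxE im eqxx rmorphN mulNr.
have lim : (i.+1 < m)%N by rewrite ltn_neqAle ni ltn_ord.
rewrite (bigD1 (Ordinal lim)) //= big1 => [|k nk].
  by rewrite !mxE (negPf ni) eqxx rmorph1 mul1r addr0.
have nk' : ((k : nat) == i.+1) = false by apply: negbTE.
by rewrite !mxE (negPf ni) nk' rmorph0 mul0r.
Qed.

(** The matrix of [V |-> C *m V + V *m D^T], with [C] and [D] the companion
    matrices, has the vectorized products [x ^+ i * y ^+ j] as an eigenvector
    for [x + y]. *)
Lemma sum_root_monic_subring (A B : comNzRingType) (iota : {rmorphism A -> B})
    (S : A -> Prop) m n (x y : B) :
  is_subring S ->
  n_integral iota (fun _ => S) m x -> n_integral iota (fun _ => S) n y ->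
  n_integral iota (fun _ => S) (n * m) (x + y).
Proof.
rewrite mulnC => hS hx hy.
(* The entry [1] of the eigenvector exists only if the degrees are positive. *)
have pos k z : n_integral iota (fun _ => S) k z -> (0 < k)%N.
  case: k => // -[a [+ a1 _]]; rewrite big_ord1 expr0 mulr1.
  have -> : ord0 = ord_max :> 'I_1 by apply: val_inj.
  by rewrite a1 rmorph1 => /eqP; rewrite oner_eq0.
have m0 := pos _ _ hx; have n0 := pos _ _ hy.
have [C SC Cx] := companion_eigen hS hx.
have [D SD Dy] := companion_eigen hS hy.
pose M : 'M[A]_(m * n) := lin_mulmx C + lin_mulmxr D^T.
have SM i j : S (M i j).
  rewrite mxE; apply: (subringD hS); apply: (subring_lin_mx hS) => N SN k l.
    exact: subring_mulmx.
  by apply: subring_mulmx => // k' l'; rewrite mxE.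
pose V : 'M[B]_(m, n) := (\col_i x ^+ i) *m (\col_j y ^+ j)^T.
have VE : mxvec V *m map_mx iota M = (x + y) *: mxvec V.
  rewrite map_mxD mulmxDr.
  rewrite (map_lin_mx (gf := mulmx (map_mx iota C))); last first.
    by move=> N; rewrite map_mxM.
  rewrite (map_lin_mx (gf := mulmxr (map_mx iota D^T))); last first.
    by move=> N; rewrite /= map_mxM.
  rewrite !mul_vec_lin /= scalerDl -![_ *: mxvec V]linearZ.
  congr (mxvec _ + mxvec _).
    by rewrite mulmxA Cx -scalemxAl.
  by rewrite -mulmxA -map_trmx -trmx_mul Dy linearZ /= -scalemxAr.
have root : (map_poly iota (char_poly M)).[x + y] = 0.
  have /(congr1 (fun v : 'rV_ _ =>
    v 0 (mxvec_index (Ordinal m0) (Ordinal n0)))) := char_poly_eigen VE.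
  by rewrite mxE mxvecE !mxE big_ord1 !mxE !expr0 !mulr1 map_char_poly.
exists (fun k => (char_poly M)`_k); split=> [||i].
- rewrite -[RHS]root (horner_coef_wide (n := (m * n).+1)).
    by apply: eq_bigr => k _; rewrite coef_map.
  by rewrite (leq_trans (size_poly _ _)) // size_char_poly.
- have /monicP := char_poly_monic M.
  by rewrite /lead_coef size_char_poly.
exact: subring_char_poly.
Qed.

(** * Homogenization *)

Lemma Rees_integral (A B : comNzRingType) (iota : {rmorphism A -> B})
    (I : nat -> A -> Prop) n (u : B) :
  subgroup_filtration I -> n_integral iota I n u ->
  n_integral (map_poly iota) (fun _ => Rees I) n (u%:P * 'X).
Proof.
move=> [_ I0 _ _] [a [ha a1 Ia]].
exists (fun k => (a k)%:P * 'X^(n - k)); split=> [||k i].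
- rewrite -[RHS](mul0r 'X^n) -[0 in RHS]polyC0 -[0 in RHS]ha.
  rewrite rmorph_sum mulr_suml; apply: eq_bigr => k _ /=.
  rewrite rmorphM /= map_polyC map_polyXn exprMn mulrACA -exprD.
  by rewrite subnK ?leq_ord // polyCM polyC_exp.
- by rewrite subnn a1 mulr1.
rewrite coefCM coefXn; case: eqP => [->|_]; last by rewrite mulr0.
by rewrite mulr1.
Qed.

(** In degree [n], the term of index [k] of the relation contributes the
    coefficient of degree [n - k] of its factor in the Rees algebra. *)
Lemma integral_of_Rees (A B : comNzRingType) (iota : {rmorphism A -> B})
    (I : nat -> A -> Prop) n (u : B) :
  n_integral (map_poly iota) (fun _ => Rees I) n (u%:P * 'X) ->
  n_integral iota I n u.
Proof.
case=> c [hc c1 Ic]; exists (fun k => (c k)`_(n - k)); split=> [||k].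
- have := congr1 (fun p : {poly B} => p`_n) hc; rewrite coef_sum coef0 => {2}<-.
  apply: eq_bigr => k _.
  rewrite exprMn -polyC_exp mulrA coefMXn ltnNge leq_ord /=.
  by rewrite coefMC coef_map.
- by rewrite c1 subnn coef1.
exact: Ic.
Qed.

Lemma n_integral_add_nz (A B : comNzRingType) (iota : {rmorphism A -> B})
    (I : nat -> A -> Prop) (x y : B) (m n : nat) :
  ideal_semifiltration I -> n_integral iota I m x -> n_integral iota I n y ->
  n_integral iota I (n * m) (x + y).
Proof.
move=> /semifiltration_subgroup hI hx hy.
apply: integral_of_Rees; rewrite polyCD mulrDl.
by apply: sum_root_monic_subring;
  [exact: Rees_subring | exact: Rees_integral | exact: Rees_integral].
Qed.

Lemma n_integral_zero_ring (A B : comPzRingType) (iota : {rmorphism A -> B})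
    (I : nat -> A -> Prop) n (u : B) :
  ideal_semifiltration I -> 1 = 0 :> B -> n_integral iota I n u.
Proof.
move=> [idI I0 _] B0; exists (fun k => ((k : nat) == n)%:R); split=> [||k].
- by rewrite -[LHS]mulr1 B0 mulr0.
- by rewrite /= eqxx.
by case: eqP => [->|_]; [rewrite subnn | case: (idI (n - k)%N)].
Qed.

Unset Implicit Arguments.
Set Strict Implicit.

Theorem theorem2p13 (A B : comPzRingType) (iota : {rmorphism A -> B})
    (I : nat -> A -> Prop) (hI : ideal_semifiltration I)
    (x y : B) (m n : nat)
    (hx : n_integral iota I m x) (hy : n_integral iota I n y) :
  n_integral iota I (n * m)%N (x + y).
Proof.
have [B0 | B1] := eqVneq (1 : B) 0; first exact: n_integral_zero_ring.
have A1 : (1 : A) != 0.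
  by apply: contraNneq B1 => A0; rewrite -(rmorph1 iota) A0 rmorph0.
(* As [1 != 0] in both rings, their given structures extend to nonzero ones. *)
pose A' : comNzRingType := HB.pack (GRing.ComPzRing.sort A)
  (GRing.ComPzRing.class A) (GRing.PzSemiRing_isNonZero.Build A A1).
pose B' : comNzRingType := HB.pack (GRing.ComPzRing.sort B)
  (GRing.ComPzRing.class B) (GRing.PzSemiRing_isNonZero.Build B B1).
exact: (@n_integral_add_nz A' B' iota I x y m n hI hx hy).
Qed.
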